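(* Let $T>0$, $I=[0,T]$, and let $\kappa\in\mathscr{K}_{\mathrm{gen}}$ be a generalized admissible kernel. Then: (1) If $\kappa(\tau)\ge 0$ for almost every $\tau\in I$, then for every $f\in\mathcal{C}(I)$ and every $t\in I$, $$\int_0^t\kappa(t-s)|f(s)|\,ds\le\|f\|_\infty\int_0^T\kappa(\tau)\,d\tau.$$ (2) In general ($\kappa$ possibly sign-changing), for every $f,g\in\mathcal{C}(I)$ and every $t\in I$, $$\left|\int_0^t\kappa(t-s)f(s)\,ds\right|\le\|f\|_\infty\int_0^T|\kappa(\tau)|\,d\tau,$$ $$\left|\int_0^t\kappa(t-s)\bigl(f(s)-g(s)\bigr)\,ds\right|\le\|f-g\|_\infty\int_0^T|\kappa(\tau)|\,d\tau.$$
   Context: $\mathcal{C}(I)$ is the set of continuous functions $I\to\mathbb{R}$ and $\|f\|_\infty:=\sup_{t\in I}|f(t)|$. Generalized admissible kernels: $\mathscr{K}_{\mathrm{gen}}$ is the set of functions $\kappa:I\to\mathbb{R}$ such that: (essential boundedness) $\kappa\in L^\infty(I)$, i.e. there is $C_\kappa>0$ with $|\kappa(\tau)|\le C_\kappa$ for almost every $\tau\in I$; (integrability and non-degeneracy) $\kappa\in L^1(I)$ and there is $\delta_\kappa>0$ with $\left|\int_0^T\kappa(\tau)\,d\tau\right|\ge\delta_\kappa$; (bounded variation) $\kappa$ has finite total variation on $I$, i.e. $\sup\sum_{i=1}^n|\kappa(\tau_i)-\kappa(\tau_{i-1})|<\infty$, the supremum being over all partitions $0=\tau_0<\tau_1<\cdots<\tau_n=T$.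 *)

(* Defs.v *)
From HB Require Import structures.
From mathcomp Require Import all_boot all_order all_algebra.
From mathcomp Require Import all_classical all_reals all_analysis.
Import Order.TTheory GRing.Theory Num.Theory.
Import numFieldNormedType.Exports.

Set Implicit Arguments.
Unset Strict Implicit.
Unset Printing Implicit Defensive.

Local Open Scope classical_set_scope.
Local Open Scope ring_scope.

(* Functions on [0, T] are represented by total functions R -> R of which only
   the values on `[0, T] matter. *)

Definition continuous_on {R : realType} (T : R) (f : R -> R) : Prop :=
  {within `[0, T], continuous f}.

Definition sup_norm {R : realType} (T : R) (f : R -> R) : R :=
  sup [set `|f t| | t in `[0, T]].

Record generalized_admissible {R : realType} (T : R) (kappa : R -> R) : Prop :=
  GeneralizedAdmissible {
    ga_measurable : measurable_fun `[0, T] kappa;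
    ga_ess_bounded : exists2 C : R, 0 < C &
      {ae (@lebesgue_measure R), forall tau, tau \in `[0, T] -> `|kappa tau| <= C};
    ga_integrable :
      (@lebesgue_measure R).-integrable `[0, T] (EFin \o kappa);
    ga_nondegenerate : exists2 delta : R, 0 < delta &
      delta <= `|\int[@lebesgue_measure R]_(tau in `[0, T]) kappa tau|;
    ga_bounded_variation : bounded_variation 0 T kappa
  }.

(* Main.v *)
Require Import Defs.
From HB Require Import structures.
From mathcomp Require Import all_boot all_order all_algebra.
From mathcomp Require Import all_classical all_reals all_analysis.
From mathcomp Require Import measurable_realfun lra.
Import Order.TTheory GRing.Theory Num.Theory.
Import numFieldNormedType.Exports.

Local Open Scope classical_set_scope.
Local Open Scope ring_scope.

(** Each of the three estimates is an instance of the [L^1]-[L^oo] bound for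
the truncated convolution of [kappa] with a function [f] bounded by [M]
([norm_convolution_le]). Pulling [M] out of the integral leaves the integral
of [|kappa (t - s)|] over [0 <= s <= t]. Lebesgue measure is invariant under
the reflection [s |-> t - s], which maps [[0, t]] onto itself, so this is the
integral of [|kappa|] over [[0, t]], and that can only grow when the domain is
enlarged to [[0, T]] ([Rintegral_norm_reflect_le]). For continuous [f] the sup
norm is finite by compactness, so it may serve as [M].

The bound for a difference is the case of the continuous function [f - g]. The
bound for a nonnegative kernel is the case of [|f|], which has the sup norm of
[f]; the absolute value around [kappa] disappears because a function and its
absolute value have the same integral when the function is nonnegative almost
everywhere ([Rintegral_norm_ae_ge0]). *)

Lemma measurable_reflect (R : realType) (t : R) :
  measurable_fun [set: measurableTypeR R] ((fun s => t - s) : _ -> measurableTypeR R).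
Proof. exact: measurable_funB. Qed.

(** Both sides are measures, and they agree on half-open intervals, which the
reflection maps to intervals of the same length. *)
Lemma lebesgue_measure_reflect (R : realType) (t : R) (A : set R) :
  measurable A ->
  pushforward lebesgue_measure
    ((fun s => t - s) : _ -> measurableTypeR R) A = lebesgue_measure A.
Proof.
(* In the context so that the pushforward is recognized as a measure. *)
have mreflect := measurable_reflect R t.
move=> mA.
apply/esym/lebesgue_measure_unique => //= _ [[a b]] _ <-.
rewrite /pushforward.
have -> : ((fun s : R => t - s) @^-1` `]a, b]) = `[t - b, t - a[%classic.
  by apply/seteqP; split => s /=; rewrite !in_itv/= => /andP[h1 h2]; lra.
rewrite !lebesgue_measure_itv/= !lte_fin ltrD2l ltrN2.
by case: ifP => // _; rewrite -!EFinB; congr EFin; lra.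
Qed.

Lemma preimage_reflect_itv (R : realType) (t : R) :
  ((fun s => t - s) : _ -> measurableTypeR R) @^-1` `[0, t] = `[0, t]%classic.
Proof.
by apply/seteqP; split => s /=; rewrite !in_itv/= => /andP[? ?]; lra.
Qed.

Lemma measurable_fun_reflect (R : realType) (t : R) (h : R -> R) :
  measurable_fun `[0, t] h -> measurable_fun `[0, t] (fun s => h (t - s)).
Proof.
move=> mh; apply: (measurable_comp (F := `[0, t]%classic)) mh _ => //.
- by rewrite -{1}preimage_reflect_itv => _ [s /= ? <-].
- exact: measurable_funS (measurable_reflect R t).
Qed.

(** Change of variables for the reflection. Unlike substitution rules that rest
on the fundamental theorem of calculus, it asks for no continuity of [h], and
so it applies to kernels with jumps. *)
Lemma ge0_integral_reflect (R : realType) (t : R) (h : R -> \bar R) :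
  measurable_fun `[0, t] h -> (forall s, (0 <= h s)%E) ->
  (\int[@lebesgue_measure R]_(s in `[0%R, t]) h (t - s)%R
   = \int[@lebesgue_measure R]_(s in `[0%R, t]) h s)%E.
Proof.
move=> mh h0.
have := ge0_integral_pushforward (measurable_reflect R t) lebesgue_measure
  (measurable_itv _) mh (fun s _ => h0 s).
rewrite preimage_reflect_itv => <-.
apply: eq_measure_integral => [|? A mA _]; first exact: measurable_reflect.
exact: lebesgue_measure_reflect.
Qed.

Lemma integrable_reflect (R : realType) (t : R) (h : R -> R) :
  lebesgue_measure.-integrable `[0, t] (EFin \o h) ->
  lebesgue_measure.-integrable `[0, t] (EFin \o (fun s => h (t - s))).
Proof.
move=> /integrableP[/measurable_EFinP mh hoo]; apply/integrableP; split.
  by apply/measurable_EFinP; apply: measurable_fun_reflect.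
rewrite (ge0_integral_reflect R t (fun s => `|(h s)%:E|%E))//.
by apply/measurable_EFinP; exact: measurableT_comp.
Qed.

(** Integrability is essential here: a real-valued integral sends [+oo] to [0], so
enlarging the domain of a nonnegative integrand could otherwise decrease it. *)
Lemma Rintegral_norm_reflect_le (R : realType) (t T : R) (h : R -> R) :
  t <= T -> lebesgue_measure.-integrable `[0, T] (EFin \o h) ->
  \int[@lebesgue_measure R]_(s in `[0, t]) `|h (t - s)|
    <= \int[@lebesgue_measure R]_(s in `[0, T]) `|h s|.
Proof.
move=> tT /integrableP[/measurable_EFinP mh hoo].
have mnh : measurable_fun `[0, T] (fun s => `|h s|%:E).
  by apply/measurable_EFinP; exact: measurableT_comp.
have sub : `[0, t]%classic `<=` `[0, T]%classic.
  by move=> s /=; rewrite !in_itv/= => /andP[-> /le_trans ->].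
rewrite /Rintegral (ge0_integral_reflect R t (fun s => `|h s|%:E))//; last first.
  exact: measurable_funS mnh.
have le_tT : (\int[@lebesgue_measure R]_(s in `[0%R, t]) `|h s|%:E
    <= \int[@lebesgue_measure R]_(s in `[0%R, T]) `|h s|%:E)%E.
  exact: ge0_subset_integral.
apply: fine_le => //; rewrite ge0_fin_numE ?integral_ge0//.
exact: le_lt_trans hoo.
Qed.

(** The [L^1]-[L^oo] case of Young's convolution inequality, for the convolution
truncated to [[0, t]]. *)
Lemma norm_convolution_le (R : realType) (t T M : R) (kappa f : R -> R) :
  t <= T -> lebesgue_measure.-integrable `[0, T] (EFin \o kappa) ->
  measurable_fun `[0, T] f -> {in `[0, T], forall s, `|f s| <= M} -> 0 <= M ->
  `|\int[@lebesgue_measure R]_(s in `[0, t]) (kappa (t - s) * f s)|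
    <= M * \int[@lebesgue_measure R]_(s in `[0, T]) `|kappa s|.
Proof.
move=> tT kT mf fM M0.
have sub : `[0, t]%classic `<=` `[0, T]%classic.
  by move=> s /=; rewrite !in_itv/= => /andP[-> /le_trans ->].
have kt0 : lebesgue_measure.-integrable `[0, t] (EFin \o kappa).
  by apply: integrableS kT.
have kt : lebesgue_measure.-integrable `[0, t]
    (EFin \o (fun s => `|kappa (t - s)|)).
  exact/integrable_norm/integrable_reflect.
have Mkt : lebesgue_measure.-integrable `[0, t]
    (EFin \o (fun s => M * `|kappa (t - s)|)).
  exact: (integrableZl _ M kt).
have le s : `[0, t]%classic s ->
    `|kappa (t - s) * f s| <= M * `|kappa (t - s)|.
  by move=> /sub st; rewrite normrM mulrC ler_wpM2r// fM.
have kf : lebesgue_measure.-integrable `[0, t]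
    (EFin \o (fun s => kappa (t - s) * f s)).
  apply: le_integrable Mkt => //.
    apply/measurable_EFinP/measurable_funM; last exact: measurable_funS mf.
    apply: measurable_fun_reflect; apply/measurable_EFinP.
    exact: measurable_int kt0.
  by move=> s /le h /=; rewrite lee_fin (le_trans h)// ler_norm.
apply: (le_trans (le_normr_Rintegral _ kf)) => //.
apply: (@le_trans _ _
  (\int[@lebesgue_measure R]_(s in `[0, t]) (M * `|kappa (t - s)|))).
  by apply: le_Rintegral => //; exact: integrable_norm.
rewrite RintegralZl//; apply: ler_wpM2l => //.
exact: Rintegral_norm_reflect_le.
Qed.

(** [sup] is a junk value on unbounded sets; the extreme value theorem provides
the upper bound that makes it a genuine supremum. *)
Lemma normr_le_sup_norm (R : realType) (T : R) (f : R -> R) :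
  continuous_on T f -> {in `[0, T], forall s, `|f s| <= sup_norm T f}.
Proof.
move=> cf s sT; apply: ub_le_sup; last by exists s.
have T0 : 0 <= T by move: sT; rewrite in_itv/= => /andP[]; exact: le_trans.
have cnf : {within `[0, T], continuous (fun s => `|f s|)}.
  by move=> x; apply: continuous_comp; [exact: cf|exact: norm_continuous].
have [c _ cmax] := EVT_max T0 cnf.
by exists `|f c| => _ [x /= xT <-]; exact: cmax.
Qed.

Lemma norm_convolution_sup_norm (R : realType) (t T : R) (kappa f : R -> R) :
  t \in `[0, T] -> lebesgue_measure.-integrable `[0, T] (EFin \o kappa) ->
  continuous_on T f ->
  `|\int[@lebesgue_measure R]_(s in `[0, t]) (kappa (t - s) * f s)|
    <= sup_norm T f * \int[@lebesgue_measure R]_(s in `[0, T]) `|kappa s|.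
Proof.
move=> tT kT cf; have fM := normr_le_sup_norm R T f cf.
apply: norm_convolution_le => //.
- by move: tT; rewrite in_itv/= => /andP[].
- exact: subspace_continuous_measurable_fun.
- exact: le_trans (fM t tT).
Qed.

Lemma Rintegral_norm_ae_ge0 (R : realType) (T : R) (kappa : R -> R) :
  measurable_fun `[0, T] kappa ->
  {ae (@lebesgue_measure R), forall tau, tau \in `[0, T] -> 0 <= kappa tau} ->
  \int[@lebesgue_measure R]_(tau in `[0, T]) `|kappa tau|
    = \int[@lebesgue_measure R]_(tau in `[0, T]) kappa tau.
Proof.
move=> mk k0; congr fine; apply: ae_eq_integral => //.
- by apply/measurable_EFinP; exact: measurableT_comp.
- exact/measurable_EFinP.
- case: k0 => N [mN N0 subN]; exists N; split=> // x nx; apply: subN => k0x.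
  by apply: nx => xT; rewrite /= ger0_norm// k0x.
Qed.

Theorem proposition2p1 (R : realType) (T : R) (kappa : R -> R)
    (T_gt0 : 0 < T) (kappa_gen : generalized_admissible T kappa) :
  ({ae (@lebesgue_measure R), forall tau, tau \in `[0, T] -> 0 <= kappa tau} ->
    forall (f : R -> R), continuous_on T f ->
    forall t : R, t \in `[0, T] ->
      \int[@lebesgue_measure R]_(s in `[0, t]) (kappa (t - s) * `|f s|)
        <= sup_norm T f * \int[@lebesgue_measure R]_(tau in `[0, T]) kappa tau)
  /\
  (forall (f g : R -> R), continuous_on T f -> continuous_on T g ->
    forall t : R, t \in `[0, T] ->
      `|\int[@lebesgue_measure R]_(s in `[0, t]) (kappa (t - s) * f s)|
        <= sup_norm T f * \int[@lebesgue_measure R]_(tau in `[0, T]) `|kappa tau|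
      /\
      `|\int[@lebesgue_measure R]_(s in `[0, t]) (kappa (t - s) * (f s - g s))|
        <= sup_norm T (fun s => f s - g s)
           * \int[@lebesgue_measure R]_(tau in `[0, T]) `|kappa tau|).
Proof.
have kT := ga_integrable kappa_gen.
split=> [k0 f cf t tT|f g cf cg t tT].
  have cnf : continuous_on T (fun s => `|f s|).
    by move=> x; apply: continuous_comp; [exact: cf|exact: norm_continuous].
  have sup_normN : sup_norm T (fun s => `|f s|) = sup_norm T f.
    by rewrite /sup_norm; under eq_imagel do rewrite normr_id.
  rewrite -(Rintegral_norm_ae_ge0 R T kappa (ga_measurable kappa_gen) k0).
  rewrite -sup_normN; apply: le_trans (ler_norm _) _.
  exact: norm_convolution_sup_norm.
split; first exact: norm_convolution_sup_norm.
apply: norm_convolution_sup_norm => // x.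
by apply: continuousB; [exact: cf|exact: cg].
Qed.
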